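(* Let $\{a_i\}_{i\ge 0}$ and $\{b_i\}_{i\ge 0}$ be sequences of non-negative integers such that $a_i\ge 1$ and $a_i\ge b_i$ for all $i\ge 1$, and such that for every $n\ge 1$, $a_n=b_n$ implies $b_{n+1}\neq 0$. Then there exist real numbers $\alpha$ and $\beta$ such that the ordered pair $(\{a_i\}_{i\ge 0},\{b_i\}_{i\ge 0})$ is a proper BCF representation of $(\alpha,\beta)$; moreover, this ordered pair of sequences is the BCF expansion of $(\alpha,\beta)$, and it is a Fibonacci Tree representation of $(\alpha,\beta)$.
   Context: BCF expansion: for positive reals $\alpha,\beta$, put $\alpha_0=\alpha$, $\beta_0=\beta$ and, for $i\ge 0$, $a_i=\lfloor\alpha_i\rfloor$, $b_i=\lfloor\beta_i\rfloor$, $\alpha_{i+1}=1/(\beta_i-b_i)$, $\beta_{i+1}=(\alpha_i-a_i)/(\beta_i-b_i)$. The algorithm stops at the first $n$ for which $\beta_n$ is an integer (the expansion is then called finite); if no $\beta_n$ is an integer, the expansion is infinite and is the ordered pair of sequences $(\{a_i\}_{i\ge 0},\{b_i\}_{i\ge 0})$. Fibonacci Tree sum: the ordered pair of real numbers $[\{a_0,\ldots,a_{n-1},x\},\{b_0,\ldots,b_{n-1},y\}]$ is defined recursively by $[\{x\},\{y\}]=(x,y)$ and, for $n\ge 1$, $[\{a_0,\ldots,a_{n-1},x\},\{b_0,\ldots,b_{n-1},y\}]=[\{a_0,\ldots,a_{n-2},a_{n-1}+y/x\},\{b_0,\ldots,b_{n-2},b_{n-1}+1/x\}]$. Proper BCF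 representation: an ordered pair of non-negative integer sequences $(\{a_i\}_{i\ge0},\{b_i\}_{i\ge0})$ is a proper BCF representation of $(\alpha,\beta)$, where $\alpha,\beta$ are positive reals, if for every $n\ge 0$ there exist positive reals $\alpha_n,\beta_n$ such that $(\alpha,\beta)=[\{a_0,\ldots,a_{n-1},\alpha_n\},\{b_0,\ldots,b_{n-1},\beta_n\}]$, and $\alpha_n>1$ and $\alpha_n>\beta_n$ for all $n\ge 1$. Fibonacci Tree representation: an ordered pair of non-negative integer sequences $(\{a_i\}_{i\ge0},\{b_i\}_{i\ge0})$ is a Fibonacci Tree representation of $(\alpha,\beta)$ if the sums $(\alpha^{(n)},\beta^{(n)})=[\{a_0,\ldots,a_n\},\{b_0,\ldots,b_n\}]$ satisfy $\lim_{n\to\infty}(\alpha^{(n)},\beta^{(n)})=(\alpha,\beta)$. *)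

(* Defs.v *)
From HB Require Import structures.
From mathcomp Require Import all_boot all_order all_algebra.
From mathcomp Require Import all_classical all_reals all_analysis.

Set Implicit Arguments.
Unset Strict Implicit.
Unset Printing Implicit Defensive.

Import Order.TTheory GRing.Theory Num.Theory.
Import numFieldNormedType.Exports.

Local Open Scope classical_set_scope.
Local Open Scope ring_scope.

(* The pair (alpha_n, beta_n). The algorithm stops at the first n for which
   beta_n is an integer; since x / 0 = 0, the pairs of larger index are then
   meaningless. *)
Fixpoint bcf_iter (R : realType) (alpha beta : R) (n : nat) : R * R :=
  if n is m.+1 then
    let: (x, y) := bcf_iter alpha beta m in
    (1 / (y - (Num.floor y)%:~R),
     (x - (Num.floor x)%:~R) / (y - (Num.floor y)%:~R))
  else (alpha, beta).

Definition bcf_finite (R : realType) (alpha beta : R) : Prop :=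
  exists n : nat, (bcf_iter alpha beta n).2 \is a Num.int.

(* The expansion of (alpha, beta) is infinite, and is the pair (a, b). *)
Definition is_bcf_expansion (R : realType) (a b : nat -> nat)
    (alpha beta : R) : Prop :=
  [/\ 0 < alpha, 0 < beta, ~ bcf_finite alpha beta &
    forall i : nat,
      Num.floor (bcf_iter alpha beta i).1 = (a i)%:Z /\
      Num.floor (bcf_iter alpha beta i).2 = (b i)%:Z].

(* [{a_0, ..., a_(n-1), x}, {b_0, ..., b_(n-1), y}]. It is meaningful only if no
   division by 0 occurs, for instance if x > 0, y >= 0, and a_i >= 1 for i >= 1. *)
Fixpoint fib_tree_sum (R : realType) (a b : nat -> nat) (n : nat)
    (x y : R) : R * R :=
  if n is m.+1 then fib_tree_sum a b m ((a m)%:R + y / x) ((b m)%:R + 1 / x)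
  else (x, y).

Definition proper_bcf_representation (R : realType) (a b : nat -> nat)
    (alpha beta : R) : Prop :=
  [/\ 0 < alpha, 0 < beta &
    forall n : nat, exists alpha_n beta_n : R,
      [/\ 0 < alpha_n, 0 < beta_n,
          (alpha, beta) = fib_tree_sum a b n alpha_n beta_n &
          (1 <= n)%N -> 1 < alpha_n /\ beta_n < alpha_n]].

Definition fib_tree_representation (R : realType) (a b : nat -> nat)
    (alpha beta : R) : Prop :=
  (fun n : nat => fib_tree_sum a b n (a n)%:R (b n)%:R : R * R) @ \oo
    --> (alpha, beta).

(* Main.v *)
(* Projectively (x, y) |-> (a + y/x, b + 1/x) is linear, so the two coordinates
   of the n-th Fibonacci Tree sum are p_n/r_n and q_n/r_n, where p, q, r all
   satisfy v_n = a_n v_(n-1) + b_n v_(n-2) + v_(n-3). Hence each sum is a convex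
   combination of the three preceding ones; as r is nondecreasing and
   a_n >= b_n, the weight of the immediately preceding one is at least 1/3, and
   this makes the sums converge. Applied to every shift of (a, b), this gives
   positive limits (x_k, y_k) with x_k = a_k + y_(k+1)/x_(k+1) and
   y_k = b_k + 1/x_(k+1).
   With the conditions on (a, b), these equations and positivity imply x_k > 1
   and x_k > y_k for k >= 1, hence a_k and b_k are the floors of x_k and y_k. *)
Require Import Defs.
From HB Require Import structures.
From mathcomp Require Import all_boot all_order all_algebra.
From mathcomp Require Import all_classical all_reals all_analysis.
From mathcomp Require Import ring lra.

Set Implicit Arguments.
Unset Strict Implicit.
Unset Printing Implicit Defensive.

Import Order.TTheory GRing.Theory Num.Theory.
Import numFieldNormedType.Exports.

Local Open Scope classical_set_scope.
Local Open Scope ring_scope.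

(** * Recurrences by convex combinations *)

Lemma convex_third_ge (R : realFieldType) (lo l m k x y z : R) :
  1 / 3 <= l -> 0 <= m -> 0 <= k -> l + m + k = 1 ->
  lo <= x -> lo <= y -> lo <= z ->
  lo + (x - lo) / 3 <= l * x + m * y + k * z.
Proof.
move=> hl hm hk s hx hy hz.
have lx : 0 <= (l - 1 / 3) * (x - lo) by rewrite mulr_ge0// subr_ge0.
have my : 0 <= m * (y - lo) by rewrite mulr_ge0// subr_ge0.
have kz : 0 <= k * (z - lo) by rewrite mulr_ge0// subr_ge0.
have kE : k = 1 - l - m by lra.
by rewrite kE in kz *; lra.
Qed.

Lemma convex_third_le (R : realFieldType) (hi l m k x y z : R) :
  1 / 3 <= l -> 0 <= m -> 0 <= k -> l + m + k = 1 ->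
  x <= hi -> y <= hi -> z <= hi ->
  l * x + m * y + k * z <= hi - (hi - x) / 3.
Proof.
move=> hl hm hk s hx hy hz.
have := @convex_third_ge _ (- hi) l m k (- x) (- y) (- z) hl hm hk s.
by rewrite !lerN2 !mulrN => /(_ hx hy hz); lra.
Qed.

(** An interval holding three consecutive terms holds all later ones. Such intervals can be chosen
    with geometrically decreasing widths, so the sequence is Cauchy. *)
Lemma cvg_convex_recurrence (R : realType) (u : R^nat) :
  (forall n, exists l m k : R,
    [/\ 1 / 3 <= l, 0 <= m, 0 <= k, l + m + k = 1 &
        u n.+3 = l * u n.+2 + m * u n.+1 + k * u n]) ->
  cvgn u.
Proof.
move=> uE.
have stable lo hi N : lo <= u N <= hi -> lo <= u N.+1 <= hi ->
    lo <= u N.+2 <= hi -> forall i, (N <= i)%N -> lo <= u i <= hi.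
  move=> h0 h1 h2 i /subnK <-.
  suff: [/\ lo <= u (i - N + N)%N <= hi, lo <= u (i - N + N).+1 <= hi &
            lo <= u (i - N + N).+2 <= hi] by case.
  elim: (i - N)%N => [//|j [g0 g1 g2]]; rewrite addSn; split => //.
  have [l [m [k [hl hm hk s ->]]]] := uE (j + N)%N.
  move: g0 g1 g2 => /andP[g0 g0'] /andP[g1 g1'] /andP[g2 g2'].
  have := convex_third_ge hl hm hk s g2 g1 g0.
  have := convex_third_le hl hm hk s g2' g1' g0'.
  by move=> ? ?; apply/andP; split; lra.
pose C := `|u 0%N| + `|u 1%N| + `|u 2%N|.
have shrink j : exists N lo hi, (forall i, (N <= i)%N -> lo <= u i <= hi) /\
    hi - lo <= (8 / 9) ^+ j * (2 * C).
  elim: j => [|j [N [lo [hi [bnd wid]]]]].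
    have h0 := normr_ge0 (u 0%N); have h1 := normr_ge0 (u 1%N).
    have h2 := normr_ge0 (u 2%N).
    exists 0%N, (- C), C; split; last by rewrite expr0; lra.
    by apply: stable; rewrite -ler_norml /C; lra.
  pose t := u N.+2.
  (* The weight bound moves both ends of the interval towards t, by a ninth of
     their distance to t after two steps: the width shrinks by 8/9. *)
  exists N.+2, (lo + (t - lo) / 9), (hi - (hi - t) / 9); split; last first.
    by rewrite exprS; lra.
  have /andP[b1 b1'] := bnd N.+1 (leqnSn _).
  have /andP[b0 b0'] := bnd N (leqnn _).
  have /andP[b2 b2'] : lo <= u N.+2 <= hi by apply: bnd; rewrite !leqW.
  have [l [m [k [hl hm hk s u3]]]] := uE N.
  have [l' [m' [k' [hl' hm' hk' s' u4]]]] := uE N.+1.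
  have := convex_third_ge hl hm hk s b2 b1 b0.
  have := convex_third_le hl hm hk s b2' b1' b0'.
  have /andP[b3 b3'] : lo <= u N.+3 <= hi by apply: bnd; rewrite !leqW.
  have := convex_third_ge hl' hm' hk' s' b3 b2 b1.
  have := convex_third_le hl' hm' hk' s' b3' b2' b1'.
  rewrite -u3 -u4 -/t => hi4 lo4 hi3 lo3.
  rewrite -/t in b2 b2'.
  by apply: stable; rewrite -/t; apply/andP; split; lra.
apply/cauchy_cvgP/cauchy_exP => e e0.
have C0 : 0 <= C by rewrite /C !addr_ge0.
have : (fun j => (8 / 9 : R) ^+ j * (2 * C)) @ \oo --> (0 : R).
  rewrite -[0](mul0r (2 * C)); apply: cvgM; last exact: cvg_cst.
  by apply: cvg_expr; rewrite ger0_norm; lra.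
move=> /cvgrPdist_lt/(_ e e0)[j _ /(_ j (leqnn j))] /=.
rewrite sub0r normrN => hj.
have [N [lo [hi [bnd wid]]]] := shrink j.
exists (u N); exists N => // i /= /bnd /andP[li ui].
have /andP[lN uN] := bnd N (leqnn N).
rewrite /ball /=; apply: le_lt_trans hj; apply: (le_trans _ (ler_norm _)).
by apply: (le_trans _ wid); rewrite ler_norml; apply/andP; split; lra.
Qed.

(* The state at n is (v_(n-1), v_(n-2), v_(n-3)). *)
Fixpoint recurrence_state (R : realType) (a b : nat -> nat) (e : R * R * R)
    (n : nat) : R * R * R :=
  if n is m.+1 then
    let: (x, y, z) := recurrence_state a b e m in
    ((a m)%:R * x + (b m)%:R * y + z, x, y)
  else e.

(** This is [v_n] with reals [x], [y] in place of [a n], [b n], which yields numerators and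
    denominators of tree sums with arbitrary last entries. *)
Definition recurrence_form (R : realType) (a b : nat -> nat) (e : R * R * R)
    (n : nat) (x y : R) : R :=
  let: (u, v, w) := recurrence_state a b e n in x * u + y * v + w.

Definition recurrence_term (R : realType) (a b : nat -> nat) (e : R * R * R)
    (n : nat) : R :=
  recurrence_form a b e n (a n)%:R (b n)%:R.

(** The index starts at 3 because only then are all three entries of the state terms, none of them
    coming from [e]. *)
Lemma recurrence_termS3 (R : realType) (a b : nat -> nat) (e : R * R * R) n :
  recurrence_term a b e n.+3 =
  (a n.+3)%:R * recurrence_term a b e n.+2
  + (b n.+3)%:R * recurrence_term a b e n.+1 + recurrence_term a b e n.
Proof.
rewrite /recurrence_term /recurrence_form /=.
by case: (recurrence_state a b e n) => [[u v] w].
Qed.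

(** The factor [x] does not depend on [e], so it cancels in quotients of two forms. *)
Lemma recurrence_formS (R : realType) (a b : nat -> nat) (e : R * R * R) n
    (x y : R) : x != 0 ->
  recurrence_form a b e n.+1 x y =
  x * recurrence_form a b e n ((a n)%:R + y / x) ((b n)%:R + 1 / x).
Proof.
move=> x0; rewrite /recurrence_form /=.
by case: (recurrence_state a b e n) => [[u v] w]; field.
Qed.

Definition shift (f : nat -> nat) (k n : nat) : nat := f (k + n)%N.

(** The definition unfolds at the last entries; unfolding at the first ones instead relates the sums
    of consecutive shifts. *)
Lemma fib_tree_sum_shift (R : realType) (a b : nat -> nat) k n (x y : R) :
  fib_tree_sum (shift a k) (shift b k) n.+1 x y =
  let: (u, v) := fib_tree_sum (shift a k.+1) (shift b k.+1) n x y in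
  ((a k)%:R + v / u, (b k)%:R + 1 / u).
Proof.
elim: n x y => [|n IHn] x y; first by rewrite /= /shift addn0.
by rewrite [LHS]IHn /= /shift addSnnS.
Qed.

Lemma fib_tree_sum_ge0 (R : realType) (a b : nat -> nat) n (x y : R) :
  0 <= x -> 0 <= y ->
  0 <= (fib_tree_sum a b n x y).1 /\ 0 <= (fib_tree_sum a b n x y).2.
Proof.
elim: n x y => [//|n IHn] x y x0 y0.
by apply: IHn; rewrite addr_ge0// divr_ge0.
Qed.

(** * Convergence of the tree sums *)

Section Representation.
Variables (R : realType) (a b : nat -> nat).
Hypothesis a_ge1 : forall i : nat, (1 <= i)%N -> (1 <= a i)%N.

(** The three unit vectors make the forms at [n = 0] equal to [x], [y] and [1]. Positivity is asked
    for [0 < n] only, since [a 0] may vanish. *)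
Lemma fib_tree_sumE n (x y : R) : ((0 < n)%N -> 0 < x /\ 0 <= y) ->
  fib_tree_sum a b n x y =
  (recurrence_form a b (1, 0, 0) n x y / recurrence_form a b (0, 0, 1) n x y,
   recurrence_form a b (0, 1, 0) n x y / recurrence_form a b (0, 0, 1) n x y).
Proof.
elim: n x y => [|n IHn] x y xy.
  by rewrite /recurrence_form /=; congr pair; field.
have [x0 y0] := xy isT; have xn0 := lt0r_neq0 x0.
rewrite [LHS]IHn => [|n0].
  by rewrite !recurrence_formS// -!mulf_div divff// !mul1r.
split; last by rewrite addr_ge0// divr_ge0// ltW.
by rewrite ltr_pwDl ?divr_ge0 ?ltr0n ?a_ge1// ltW.
Qed.

Let r n : R := recurrence_term a b (0, 0, 1) n.

(** As [1 <= a n.+3], the first summand of the recurrence already dominates the previous term.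
    Stating three consecutive bounds makes the induction close. *)
Lemma denominator_ge1_nondecreasing n :
  [/\ 1 <= r n, r n <= r n.+1 & r n.+1 <= r n.+2].
Proof.
have A i : 1 <= (a i.+1)%:R :> R by rewrite ler1n a_ge1.
elim: n => [|n [h0 h1 h2]].
  rewrite /r /recurrence_term /recurrence_form /=.
  have := A 0%N; have := A 1%N; have := ler0n R (b 1); have := ler0n R (b 2).
  by split; nra.
split=> //; first lra.
rewrite [leRHS]recurrence_termS3 -/(r _) -/(r _) -/(r _).
by have := A n.+2; have := ler0n R (b n.+3); nra.
Qed.

Hypothesis a_geb : forall i : nat, (1 <= i)%N -> (b i <= a i)%N.

Lemma cvg_recurrence_ratio (e : R * R * R) :
  cvgn (fun n => recurrence_term a b e n / r n).
Proof.
apply: cvg_convex_recurrence => n.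
have [h0 h1 h2] := denominator_ge1_nondecreasing n.
have [_ _ h3] := denominator_ge1_nondecreasing n.+1.
have A : 1 <= (a n.+3)%:R :> R by rewrite ler1n a_ge1.
have AB : (b n.+3)%:R <= (a n.+3)%:R :> R by rewrite ler_nat a_geb.
have B0 := ler0n R (b n.+3).
have r3 : r n.+3 = (a n.+3)%:R * r n.+2 + (b n.+3)%:R * r n.+1 + r n.
  exact: recurrence_termS3.
have p3 : 0 < r n.+3 by lra.
exists ((a n.+3)%:R * r n.+2 / r n.+3), ((b n.+3)%:R * r n.+1 / r n.+3),
  (r n / r n.+3); split.
(* Since [b <= a], [1 <= a] and [r] is nondecreasing, the first of the three summands of [r n.+3] is
   the largest. *)
- by rewrite ler_pdivlMr// r3; nra.
- by rewrite divr_ge0 ?mulr_ge0//; lra.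
- by rewrite divr_ge0//; lra.
- by rewrite -!mulrDl -r3 divff// lt0r_neq0.
- rewrite recurrence_termS3; field.
  by rewrite !lt0r_neq0//; lra.
Qed.

Lemma cvg_fib_tree_sum : exists x y : R, fib_tree_representation a b x y.
Proof.
exists (limn (fun n => recurrence_term a b (1, 0, 0) n / r n)),
  (limn (fun n => recurrence_term a b (0, 1, 0) n / r n)).
rewrite /fib_tree_representation.
under eq_fun => n.
  rewrite fib_tree_sumE; last by move=> n0; rewrite ltr0n a_ge1//.
  over.
have cvg1 := @cvg_recurrence_ratio (1, 0, 0).
have cvg2 := @cvg_recurrence_ratio (0, 1, 0).
exact: (cvg_pair cvg1 cvg2).
Qed.

End Representation.

(** * Floors of positive solutions of the tail equations *)

Section PositiveTails.
Variables (R : realType) (a b : nat -> nat) (x y : nat -> R).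
Hypothesis a_ge1 : forall i : nat, (1 <= i)%N -> (1 <= a i)%N.
Hypothesis a_geb : forall i : nat, (1 <= i)%N -> (b i <= a i)%N.
Hypothesis ab_eq : forall n : nat, (1 <= n)%N -> a n = b n -> b n.+1 <> 0%N.
Hypothesis x_gt0 : forall n, 0 < x n.
Hypothesis y_gt0 : forall n, 0 < y n.
Hypothesis xE : forall n, x n = (a n)%:R + y n.+1 / x n.+1.
Hypothesis yE : forall n, y n = (b n)%:R + 1 / x n.+1.

Lemma tail_gt1 n : 1 < x n.+1.
Proof.
have q0 : 0 < y n.+2 / x n.+2 by rewrite divr_gt0.
have : 1 <= (a n.+1)%:R :> R by rewrite ler1n a_ge1.
by rewrite xE; lra.
Qed.

Lemma inv_tail_itv n : 0 < 1 / x n.+1 < 1.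
Proof.
by rewrite divr_gt0//= ltr_pdivrMr// mul1r tail_gt1.
Qed.

(** If [a n.+1 = b n.+1], the claim reduces to [1 < y n.+2], which follows from [1 <= b n.+2].
    Otherwise [a n.+1] exceeds [b n.+1] by at least 1, hence by more than [1 / x n.+2]. *)
Lemma tail_lt n : y n.+1 < x n.+1.
Proof.
have /andP[_ i1] := inv_tail_itv n.+1.
rewrite xE yE; have [ab|ab] := eqVneq (a n.+1) (b n.+1).
  rewrite ab ltrD2l ltr_pM2r ?invr_gt0// yE.
  have : 1 <= (b n.+2)%:R :> R.
    by rewrite ler1n lt0n; apply/eqP; exact: ab_eq.
  by have /andP[? _] := inv_tail_itv n.+2; lra.
have : ((b n.+1).+1 <= a n.+1)%N by rewrite ltn_neqAle eq_sym ab a_geb.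
rewrite -(ler_nat R) -natr1 => ?.
have : 0 < y n.+2 / x n.+2 by rewrite divr_gt0.
by lra.
Qed.

Lemma floor_tail n :
  Num.floor (x n) = (a n)%:Z /\ Num.floor (y n) = (b n)%:Z.
Proof.
have /andP[i0 i1] := inv_tail_itv n.
have q0 : 0 < y n.+1 / x n.+1 by rewrite divr_gt0.
have q1 : y n.+1 / x n.+1 < 1 by rewrite ltr_pdivrMr// mul1r tail_lt.
have xn := xE n; have yn := yE n.
by split; apply: floor_def; rewrite intrD; apply/andP; split; lra.
Qed.

Lemma bcf_iter_tail n : bcf_iter (x 0%N) (y 0%N) n = (x n, y n).
Proof.
elim: n => //= n ->; have [-> ->] := floor_tail n.
have xn0 := lt0r_neq0 (x_gt0 n.+1).
rewrite (xE n) (yE n) -!(addrC (_ / _)) !addrK.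
by congr pair; field.
Qed.

(** An integral [y n] would equal its floor [b n], forcing [1 / x n.+1 = 0]. *)
Lemma tail_not_int n : y n \isn't a Num.int.
Proof.
apply/negP => /intrP [z yz].
have [_] := floor_tail n; rewrite yz intrKfloor => zb.
have /andP[] := inv_tail_itv n.
by move: yz; rewrite yE zb; lra.
Qed.

Lemma is_bcf_expansion_tail : is_bcf_expansion a b (x 0%N) (y 0%N).
Proof.
split=> // [[n]|n]; rewrite bcf_iter_tail; last exact: floor_tail.
by rewrite (negbTE (tail_not_int n)).
Qed.

Lemma proper_bcf_representation_tail :
  proper_bcf_representation a b (x 0%N) (y 0%N).
Proof.
split=> // n; exists (x n), (y n); split=> //; last first.
  by case: n => // n _; split; [exact: tail_gt1|exact: tail_lt].
by elim: n => //= n ->; rewrite -xE -yE.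
Qed.

End PositiveTails.

Theorem theorem2 (R : realType) (a b : nat -> nat)
  (a_ge1 : forall i : nat, (1 <= i)%N -> (1 <= a i)%N)
  (a_geb : forall i : nat, (1 <= i)%N -> (b i <= a i)%N)
  (ab_eq : forall n : nat, (1 <= n)%N -> a n = b n -> b n.+1 <> 0%N) :
  exists alpha beta : R,
    [/\ proper_bcf_representation a b alpha beta,
        is_bcf_expansion a b alpha beta &
        fib_tree_representation a b alpha beta].
Proof.
have sh k : exists xy : R * R,
    fib_tree_representation (shift a k) (shift b k) xy.1 xy.2.
  have [||x [y xy]] := @cvg_fib_tree_sum R (shift a k) (shift b k).
  - by move=> i i1; apply: a_ge1; rewrite ltn_addl.
  - by move=> i i1; apply: a_geb; rewrite ltn_addl.
  by exists (x, y).
have [xy xyP] := choice sh.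
pose x k := (xy k).1; pose y k := (xy k).2.
pose w k n : R * R := fib_tree_sum (shift a k) (shift b k) n
  (shift a k n)%:R (shift b k n)%:R.
have wS k n : w k n.+1 = ((a k)%:R + (w k.+1 n).2 / (w k.+1 n).1,
                          (b k)%:R + 1 / (w k.+1 n).1).
  have shiftS f : shift f k n.+1 = shift f k.+1 n by rewrite /shift addnS.
  rewrite /w fib_tree_sum_shift !shiftS.
  by case: fib_tree_sum.
have w0 k n : 0 <= (w k n).1 /\ 0 <= (w k n).2 by exact: fib_tree_sum_ge0.
have w1 k : (fun n => (w k n).1) @ \oo --> x k.
  apply: (cvg_comp _ _ (xyP k)); exact: cvg_fst.
have w2 k : (fun n => (w k n).2) @ \oo --> y k.
  apply: (cvg_comp _ _ (xyP k)); exact: cvg_snd.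
have wS1 k : (fun n => (w k n.+1).1) @ \oo --> x k.
  by rewrite (cvg_shiftS (fun n => (w k n).1)).
have wS2 k : (fun n => (w k n.+1).2) @ \oo --> y k.
  by rewrite (cvg_shiftS (fun n => (w k n).2)).
(* Only weak inequalities survive the limit, but [1 <= a k.+1] keeps [x k.+1] away from 0, so the
   divisions in [wS] pass to the limit. *)
have xge k : (a k)%:R <= x k.
  rewrite -(cvg_lim _ (wS1 k))//; apply: limr_ge; first exact: cvgP (wS1 k).
  apply: nearW => n; rewrite wS /= lerDl.
  by have [? ?] := w0 k.+1 n; rewrite divr_ge0.
have x1 k : 1 <= x k.+1 by apply: le_trans (xge _); rewrite ler1n a_ge1.
have x0 k : x k.+1 != 0 by rewrite lt0r_neq0//; have := x1 k; lra.
have xE k : x k = (a k)%:R + y k.+1 / x k.+1.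
  have wSE : (fun n => (w k n.+1).1) =
      (fun n => (a k)%:R + (w k.+1 n).2 / (w k.+1 n).1).
    by apply/funext => n; rewrite wS.
  apply: (cvg_unique _ (wS1 k)) => //; rewrite /= wSE.
  by apply: cvgD; [exact: cvg_cst|apply: cvgM => //; exact: cvgV].
have yE k : y k = (b k)%:R + 1 / x k.+1.
  have wSE : (fun n => (w k n.+1).2) =
      (fun n => (b k)%:R + 1 / (w k.+1 n).1).
    by apply/funext => n; rewrite wS.
  apply: (cvg_unique _ (wS2 k)) => //; rewrite /= wSE.
  by apply: cvgD; [exact: cvg_cst|apply: cvgM; [exact: cvg_cst|exact: cvgV]].
(* Strict positivity comes from the limit equations: [1 / x k.+1] makes [y k] positive, and then
   [y k.+1 / x k.+1] makes [x k] positive even if [a k = 0]. *)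
have y_gt0 k : 0 < y k by rewrite yE ltr_wpDl// divr_gt0//; have := x1 k; lra.
have x_gt0 k : 0 < x k.
  by rewrite xE ltr_wpDl// divr_gt0//; have := x1 k; lra.
exists (x 0%N), (y 0%N); split.
- exact: proper_bcf_representation_tail.
- exact: is_bcf_expansion_tail.
(* [shift a 0] and [shift b 0] are convertible to [a] and [b]. *)
- exact: (xyP 0%N).
Qed.
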